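(* Let $F$ be a field of characteristic zero. Every verbally prime p.i. algebra over $F$ satisfies the primeness property for (ordinary) central polynomials.
   Context: For an associative $F$-algebra $A$, a polynomial $f(x_1,\dots,x_m)$ in the free associative algebra $F\langle X\rangle$ is an identity for $A$ if $f(a_1,\dots,a_m)=0$ for all $a_i\in A$; $A$ is a p.i. algebra if it satisfies a nonzero polynomial identity. A p.i. algebra $A$ is verbally prime if, whenever $f(x_1,\dots,x_r)$ and $g(x_{r+1},\dots,x_s)$ are polynomials in distinct variables and $f\cdot g$ is an identity for $A$, then either $f$ or $g$ is an identity for $A$. A polynomial $f$ is a central polynomial for $A$ if it is not an identity and $f(a_1,\dots,a_m)\in Z(A)$ (the centre of $A$) for all $a_i\in A$. $A$ satisfies the primeness property for central polynomials if, whenever $f(x_1,\dots,x_r)$ and $g(x_{r+1},\dots,x_s)$ are polynomials in distinct variables such that $f\cdot g$ is a central polynomial for $A$, both $f$ and $g$ are central polynomials for $A$. *)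

(* Defs.v *)
From mathcomp Require Export all_boot all_order all_algebra.
From mathcomp.finmap Require Export finmap.
From mathcomp.multinomials Require Export monalg.

Set Implicit Arguments.
Unset Strict Implicit.
Unset Printing Implicit Defensive.

Import GRing.Theory.

Local Open Scope ring_scope.

(* The free unital associative algebra F<X> on countably many variables, as
   the monoid algebra of the free monoid on nat: index i stands for x_{i+1}. *)
Notation freeAlg F := {malg F[{fmonom nat}]}.

Section Polynomials.
Variables (F : fieldType) (A : algType F).
Implicit Types f g : freeAlg F.

(* Evaluation takes a value for every variable; only those occurring in f
   matter. The factors are multiplied in the order in which they occur in m. *)
Definition polyEval (a : nat -> A) f : A :=
  mmap (fun c : F => c%:A) (fun m : {fmonom nat} => \prod_(i <- m) a i) f.

(* f only involves the variables of index i with r <= i < s. *)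
Definition varsIn (r s : nat) f : Prop :=
  forall m : {fmonom nat}, m \in msupp f -> all (fun i => (r <= i < s)%N) m.

Definition polyIdentity f : Prop := forall a : nat -> A, polyEval a f = 0.

Definition piAlgebra : Prop := exists2 f, f != 0 & polyIdentity f.

Definition verballyPrime : Prop :=
  forall (r s : nat) f g,
    (r <= s)%N -> varsIn 0 r f -> varsIn r s g ->
    polyIdentity (f * g) -> polyIdentity f \/ polyIdentity g.

(* The center is spelled out because the library's 'Z(_) only covers
   finite-dimensional algebras. *)
Definition centralPoly f : Prop :=
  ~ polyIdentity f /\
  forall (a : nat -> A) (b : A), GRing.comm (polyEval a f) b.

Definition primenessCentral : Prop :=
  forall (r s : nat) f g,
    (r <= s)%N -> varsIn 0 r f -> varsIn r s g ->
    centralPoly (f * g) -> centralPoly f /\ centralPoly g.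

End Polynomials.

Arguments piAlgebra {F} A.
Arguments verballyPrime {F} A.
Arguments primenessCentral {F} A.
Arguments polyIdentity {F} A f.
Arguments centralPoly {F} A f.

(* Main.v *)
(** Write [x, y] for the commutator. If f g is central, then so is [f, x] g
    for every x: f(a + t [a, x]) is a polynomial in t whose coefficient of t
    is [f(a), x], and over an infinite field the coefficients of a polynomial
    with central values are central.
    Hence z_u(x) = [u, x] g is central for u = f, [f, t], [[f, t], w].
    Commuting the product rule
      z_u(x y) = x z_u(y) + y z_u(x) + z_[u, x](y)
    with t shows that z_u(x) [y, t] is alternating in x, y, t. Expanding
    z_u(t w) [x, y] then shows that altForm4 = z_[u, t](w) [x, y] is alternating
    in t, w, x, y, and that 2 altForm4 = z_u(x) [y, [t, w]]; by the Jacobi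
    identity 6 altForm4 = 0. So [[f, t], w] g [x, y] = 0, with disjoint
    variables, and verbal primeness leaves two cases. Either A is commutative,
    or every [f, t] is central; then 0 = [[f, t] g, w] = [f, t] [g, w], so f or
    g takes central values only, and the other one does too since
    [f, x] g + f [g, x] = 0. *)
From HB Require Import structures.
Require Import Defs.
From mathcomp Require Import all_boot all_order all_algebra.
From mathcomp Require Import finmap monalg.

Set Implicit Arguments.
Unset Strict Implicit.
Unset Printing Implicit Defensive.

Import GRing.Theory.

Local Open Scope ring_scope.

(** * Commutator identities *)

Section Bracket.
Variable A : pzRingType.
Implicit Types x y z t u w : A.

Definition bracket x y := x * y - y * x.

Definition central z := forall y, GRing.comm z y.

Lemma bracket_eq0P x y : bracket x y = 0 <-> GRing.comm x y.
Proof.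
by split=> [/eqP|xy]; [rewrite subr_eq0 => /eqP | rewrite /bracket xy subrr].
Qed.

Lemma bracketN x y : bracket y x = - bracket x y.
Proof. by rewrite /bracket opprB. Qed.

Lemma bracketDl x y z : bracket (x + y) z = bracket x z + bracket y z.
Proof. by rewrite /bracket mulrDl mulrDr opprD addrACA. Qed.

Lemma bracketMr u x y : bracket u (x * y) = bracket u x * y + x * bracket u y.
Proof. by rewrite /bracket mulrBl mulrBr !mulrA addrA subrK. Qed.

Lemma bracketMl x y u : bracket (x * y) u = bracket x u * y + x * bracket y u.
Proof. by rewrite bracketN bracketMr opprD -mulNr -mulrN -!bracketN. Qed.

Lemma bracketBr u x y : bracket u (x - y) = bracket u x - bracket u y.
Proof.
rewrite /bracket mulrBr mulrBl !opprB addrACA [RHS]addrACA.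
by rewrite [- (u * y) - _]addrC.
Qed.

Lemma bracket_jacobi u t w :
  bracket (bracket u t) w - bracket (bracket u w) t = bracket u (bracket t w).
Proof.
rewrite [bracket t w]/bracket bracketBr !bracketMr.
set p := bracket u t; set q := bracket u w.
by rewrite /bracket opprB opprD [- (q * t) - _]addrC addrACA.
Qed.

Lemma bracketNl x y : bracket (- x) y = - bracket x y.
Proof. by rewrite /bracket mulNr mulrN opprD. Qed.

Lemma jacobi_cyclic y t w :
  bracket y (bracket t w) + bracket t (bracket w y) + bracket w (bracket y t)
  = 0.
Proof.
rewrite -bracket_jacobi [bracket t _]bracketN [bracket w y]bracketN bracketNl.
by rewrite opprK subrK [bracket w _]bracketN subrr.
Qed.

Lemma central_bracket c x : central c -> bracket c x = 0.
Proof. by move=> /(_ x)/bracket_eq0P. Qed.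

(** * Alternating forms built from central products *)

(* [z u x] stands for [u, x] g. *)
Section AlternatingForm.
Variables (L : A -> Prop) (z : A -> A -> A).
Hypothesis L_bracket : forall u x, L u -> L (bracket u x).
Hypothesis z_central : forall u x, L u -> central (z u x).
Hypothesis zM : forall u x y,
  L u -> z u (x * y) = y * z u x + x * z u y + z (bracket u x) y.
Hypothesis z_jacobi : forall u t w,
  z (bracket u t) w - z (bracket u w) t = z u (bracket t w).

Definition altForm u x y t := z u x * bracket y t.

Lemma altFormC12 u x y t : L u -> altForm u x y t = - altForm u y x t.
Proof.
move=> Lu; have := central_bracket t (z_central (x * y) Lu).
rewrite zM // !bracketDl (central_bracket _ (z_central _ (L_bracket _ Lu))).
rewrite (bracketMl y) (bracketMl x) !(central_bracket _ (z_central _ Lu)).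
rewrite !mulr0 !addr0 => /eqP; rewrite addr_eq0 => /eqP.
by rewrite /altForm -!(z_central _ Lu (bracket _ _)).
Qed.

Lemma altFormC23 u x y t : altForm u x y t = - altForm u x t y.
Proof. by rewrite /altForm [bracket y t]bracketN mulrN. Qed.

Lemma altForm_cycle u x y t : L u -> altForm u x y t = altForm u y t x.
Proof. by move=> Lu; rewrite altFormC12 // altFormC23 opprK. Qed.

Definition altForm4 u t w x y := altForm (bracket u t) w x y.

(** Expand [z u (t * w) * bracket x y] in two ways: directly by [zM], and by the Leibniz rule once a
    cyclic shift has moved [t * w] into the bracket. Comparing the two gives the claim. *)
Lemma altForm4_bracket u t w x y :
  L u -> altForm4 u t w x y = bracket (altForm u t x y) w.
Proof.
move=> Lu; have : w * altForm u t x y + t * altForm u w x y + altForm4 u t w x y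
                  = altForm u t x y * w + t * altForm u w x y.
  rewrite [in RHS]altForm_cycle // [altForm u w x y in RHS]altForm_cycle //.
  rewrite /altForm4 /altForm !mulrA -!mulrDl -zM //.
  rewrite -/(altForm u (t * w) x y) altForm_cycle // /altForm bracketMr.
  by rewrite mulrDr !mulrA [z u x * t]z_central.
by rewrite addrAC => /addIr E; rewrite /bracket -E addrAC subrr add0r.
Qed.

Lemma altForm4C34 u t w x y : altForm4 u t w x y = - altForm4 u t w y x.
Proof. exact: altFormC23. Qed.

Lemma altForm4C23 u t w x y : L u -> altForm4 u t w x y = - altForm4 u t x w y.
Proof. by move=> Lu; apply/altFormC12/L_bracket. Qed.

Lemma altForm4C13 u t w x y : L u -> altForm4 u t w x y = - altForm4 u x w t y.
Proof. by move=> Lu; rewrite !altForm4_bracket // altFormC12 // bracketNl. Qed.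

(** The transposition (12) is the product (13)(23)(13), so three signs combine to one. *)
Lemma altForm4C12 u t w x y : L u -> altForm4 u t w x y = - altForm4 u w t x y.
Proof.
by move=> Lu; rewrite altForm4C13 // altForm4C23 // altForm4C13 // opprK.
Qed.

Lemma altForm4_double u t w x y :
  L u -> altForm4 u t w x y *+ 2 = z u x * bracket y (bracket t w).
Proof.
move=> Lu; rewrite mulr2n {2}altForm4C12 // /altForm4 /altForm -mulrBl z_jacobi.
by rewrite -/(altForm u _ x y) altForm_cycle.
Qed.

(** Multiplied by [z u x], each Jacobi term in [y], [t], [w] is twice a value of [altForm4]; the
    three values differ only by even permutations. *)
Lemma altForm4_eq0 u t w x y : L u -> altForm4 u t w x y *+ 6 = 0.
Proof.
move=> Lu; have := congr1 ( *%R (z u x)) (jacobi_cyclic y t w).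
rewrite mulr0 2!mulrDr -!altForm4_double //.
have -> : altForm4 u w y x t = altForm4 u t w x y.
  rewrite altForm4C34 altForm4C23 // -altForm4C34 altForm4C12 //.
  by rewrite altForm4C23 // altForm4C34 // ?opprK.
have -> : altForm4 u y t x w = altForm4 u t w x y.
  by rewrite altForm4C12 // altForm4C34 altForm4C23 // altForm4C34 ?opprK.
by rewrite -!mulrnDr.
Qed.

End AlternatingForm.

(** Take [bracket v r * g] for [z v r]. Closure of [L] under commutators keeps the products with
    iterated commutators central. *)
Lemma bracket_bracket_eq0 (L : A -> Prop) g u t w x y :
  (forall v : A, v *+ 6 = 0 -> v = 0) ->
  (forall v, L v -> central (v * g)) ->
  (forall v r, L v -> L (bracket v r)) ->
  L u -> bracket (bracket u t) w * g * bracket x y = 0.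
Proof.
move=> tf Lg L_bracket Lu; apply/tf.
apply: (@altForm4_eq0 L (fun v r => bracket v r * g)) => //
  [v r Lv|v r s Lv|v r s].
- exact/Lg/L_bracket.
- rewrite bracketMr mulrDl -!mulrA addrAC; congr (_ + _).
  by move: (bracket v r) => p; rewrite /bracket mulrBl -!mulrA addrC subrK.
- by rewrite -mulrBl bracket_jacobi.
Qed.
End Bracket.

(** * Evaluation and renaming of variables *)

Section FreeAlgebra.
Variables (F : fieldType) (A : algType F).
Implicit Types (f g : freeAlg F) (a b : nat -> A).

Let coefA : F -> A := fun c => c%:A.

Let coefA_additive : {morph coefA : x y / x - y}.
Proof. by move=> x y; rewrite /coefA scalerBl. Qed.

HB.instance Definition _ := GRing.isZmodMorphism.Build F A coefA coefA_additive.

Lemma polyEval_is_additive a : {morph polyEval a : f g / f - g}.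
Proof. exact: (mmapB (f := coefA)). Qed.

HB.instance Definition _ a :=
  GRing.isZmodMorphism.Build (freeAlg F) A (polyEval a)
    (polyEval_is_additive a).

Lemma polyEvalU a c (m : {fmonom nat}) :
  polyEval a << c *g m >> = c *: \prod_(i <- m) a i.
Proof. by rewrite /polyEval (mmapU (f := coefA)) /coefA mulr_algl. Qed.

Lemma polyEvalM a f g : polyEval a (f * g) = polyEval a f * polyEval a g.
Proof.
rewrite malgME raddf_sum [polyEval a f]/mmap mulr_suml; apply: eq_bigr => i _.
rewrite raddf_sum [polyEval a g]/mmap mulr_sumr; apply: eq_bigr => j _.
by rewrite /= polyEvalU fmM big_cat /= !mulr_algl -scalerAl -scalerAr scalerA.
Qed.

Definition freeVar i : freeAlg F := << FMonom [:: i] >>.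

Lemma polyEval_var a i : polyEval a (freeVar i) = a i.
Proof. by rewrite polyEvalU scale1r big_seq1. Qed.

Lemma polyEval_bracket a f g :
  polyEval a (bracket f g) = bracket (polyEval a f) (polyEval a g).
Proof. by rewrite /bracket raddfB /= !polyEvalM. Qed.

Lemma varsIn_bounded f : exists n, varsIn 0 n f.
Proof.
exists (\max_(m <- msupp f) \max_(i <- m) i.+1)%N => m fm; apply/allP => i im.
by apply: leq_trans (leq_bigmax_seq _ fm _); rewrite // leq_bigmax_seq.
Qed.

Lemma eq_polyEval r s a b f :
  varsIn r s f -> (forall i, (r <= i < s)%N -> a i = b i) ->
  polyEval a f = polyEval b f.
Proof.
move=> fP ab; apply: eq_big_seq => m /fP/allP mP; congr (_ * _).
by apply: eq_big_seq => i /mP/ab.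
Qed.

Definition shift n f : freeAlg F :=
  \sum_(m <- msupp f) << f@_m *g FMonom (map (addn n) m) >>.

Lemma polyEval_shift n a f :
  polyEval a (shift n f) = polyEval (fun i => a (n + i)%N) f.
Proof.
rewrite raddf_sum; apply: eq_bigr => m _.
by rewrite /= polyEvalU big_map mulr_algl.
Qed.

Lemma varsIn_shift n s f : varsIn 0 s f -> varsIn n (n + s) (shift n f).
Proof.
move=> fP; rewrite /shift big_seq; apply: big_ind => [m|g h gP hP m|m fm k].
- by rewrite msupp0.
- by move/(fsubsetP (msuppD_le g h)); rewrite in_fsetU => /orP[/gP|/hP].
- move/(fsubsetP msuppU_le); rewrite in_fset1 => /eqP-> /=.
  rewrite all_map; apply: sub_all (fP _ fm) => i /=.
  by rewrite leq_addr ltn_add2l.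
Qed.

(** Shifting the variables of [g] past those of [f] turns verbal primeness into a statement about
    independent values of [f] and [g]. *)
Lemma verballyPrime_eval f g :
  verballyPrime A -> (forall a b, polyEval a f * polyEval b g = 0) ->
  polyIdentity A f \/ polyIdentity A g.
Proof.
move=> hvp fg0; have [[r fP] [s gP]] := (varsIn_bounded f, varsIn_bounded g).
have [a|//|gr] := hvp _ _ f (shift r g) (leq_addr s r) fP (varsIn_shift gP).
- by rewrite polyEvalM polyEval_shift.
- by left.
right=> a; rewrite -(gr (fun i => a (i - r)%N)) polyEval_shift.
by apply: eq_polyEval gP _ => i _; rewrite addKn.
Qed.

Lemma polyEval_bracket_var n f a x : varsIn 0 n f ->
  polyEval (fun i => if i == n then x else a i) (bracket f (freeVar n))
  = bracket (polyEval a f) x.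
Proof.
move=> fP; rewrite polyEval_bracket polyEval_var eqxx; congr (bracket _ _).
by apply: eq_polyEval fP _ => i /= lt_in; rewrite ltn_eqF.
Qed.

(** * Polynomials in a scalar parameter *)

Hypothesis char0 : [pchar F] =i pred0.

Lemma natr_inj_char0 : injective (fun n => n%:R : F).
Proof.
move=> m n /eqP; wlog le_mn : m n / (m <= n)%N => [IH|].
  by case/orP: (leq_total m n) => /IH // IHmn; rewrite eq_sym => /IHmn.
rewrite eq_sym -subr_eq0 -natrB // (pcharf0P _).1 // subn_eq0 => le_nm.
by apply/eqP; rewrite eqn_leq le_mn.
Qed.

(** A Vandermonde argument by induction: rescaling [t] by 2 eliminates the top term, and distinct
    powers of 2 stay distinct in characteristic zero. *)
Lemma scaled_sum_eq0 n (v : nat -> A) :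
  (forall t : F, \sum_(i < n) t ^+ i *: v i = 0) ->
  forall i, (i < n)%N -> v i = 0.
Proof.
elim: n v => [|n IHn] v v0 i //.
have v0n j : (j < n)%N -> v j = 0.
  (* P(2t) - 2^n P(t) has no term of degree n. *)
  pose w i := (2%:R ^+ i - 2%:R ^+ n : F) *: v i.
  have w0 (t : F) : \sum_(i < n) t ^+ i *: w i = 0.
    transitivity (\sum_(i < n.+1) (2%:R * t) ^+ i *: v i
                  - 2%:R ^+ n *: \sum_(i < n.+1) t ^+ i *: v i).
      rewrite scaler_sumr -sumrB big_ord_recr /= exprMn scalerA subrr addr0.
      apply: eq_bigr => k _; rewrite exprMn !scalerA -scalerBl.
      by rewrite mulrBr [t ^+ k * _]mulrC [t ^+ k * _]mulrC.
    by rewrite !v0 scaler0 subr0.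
  move=> lt_jn; have /eqP := IHn w w0 j lt_jn.
  rewrite scaler_eq0 subr_eq0 -!natrX => /orP[/eqP/natr_inj_char0/eqP|/eqP//].
  by rewrite eqn_exp2l // ltn_eqF.
rewrite ltnS leq_eqVlt => /orP[/eqP->|]; last exact: v0n.
have := v0 1; rewrite big_ord_recr /= big1 => [|j _]; last first.
  by rewrite v0n ?scaler0.
by rewrite add0r expr1n scale1r.
Qed.

Lemma poly_scalar_roots (p : {poly A}) :
  (forall t : F, p.[t%:A] = 0) -> p = 0.
Proof.
move=> p0; apply/polyP => i; rewrite coef0.
have [|/leq_sizeP] := ltnP i (size p); last exact.
apply: scaled_sum_eq0 => t; rewrite -[RHS](p0 t) horner_coef.
by apply: eq_bigr => j _; rewrite -in_algE -rmorphXn /= mulr_algr.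
Qed.

(** Scalars are central, so evaluating at them is multiplicative even over a noncommutative [A]. *)
Lemma horner_scalarM (p q : {poly A}) (t : F) :
  (p * q).[t%:A] = p.[t%:A] * q.[t%:A].
Proof. by apply: hornerM_comm; rewrite /comm_poly mulr_algl mulr_algr. Qed.

(** Commutation with [x] is a derivation, so deforming each variable along it deforms the value of
    [f] along it to first order. *)
Lemma polyEval_jet f a x : exists p : {poly A},
  [/\ forall t : F, polyEval (fun i => a i + t *: bracket (a i) x) f = p.[t%:A],
      p`_0 = polyEval a f & p`_1 = bracket (polyEval a f) x].
Proof.
(* The property holds for constants 1 and variables, and survives products, scalar multiples and
   sums, hence reaches all of [f]. *)
pose jet (u : F -> A) y := exists p : {poly A},
  [/\ forall t : F, u t = p.[t%:A], p`_0 = y & p`_1 = bracket y x].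
have jet1 : jet (fun=> 1) 1.
  exists 1; split=> [t||]; rewrite ?hornerC ?coef1 //.
  by rewrite /bracket mul1r mulr1 subrr.
have jetM u v y z : jet u y -> jet v z -> jet (fun t => u t * v t) (y * z).
  move=> [p [pE p0 p1]] [q [qE q0 q1]]; exists (p * q); split=> [t||].
  - by rewrite pE qE horner_scalarM.
  - by rewrite coef0M p0 q0.
  by rewrite coefM !big_ord_recl big_ord0 addr0 /= p0 q0 p1 q1 bracketMl addrC.
have jetZ c u y : jet u y -> jet (fun t => c *: u t) (c *: y).
  move=> [p [pE p0 p1]]; exists ((c%:A)%:P * p); split=> [t||].
  - by rewrite horner_scalarM hornerC pE mulr_algl.
  - by rewrite coefCM p0 mulr_algl.
  by rewrite coefCM p1 mulr_algl /bracket scalerBr -scalerAl -scalerAr.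
have jetV i : jet (fun t => a i + t *: bracket (a i) x) (a i).
  exists ((a i)%:P + (bracket (a i) x)%:P * 'X); split=> [t||].
  - by rewrite hornerD hornerMX !hornerC mulr_algr.
  - by rewrite coefD coefMX !coefC addr0.
  by rewrite coefD coefMX !coefC add0r.
rewrite -/(jet _ _) /polyEval /mmap.
elim: (msupp f : seq _) => [|m s [p [pE p0 p1]]].
  exists 0; split=> [t||]; rewrite ?big_nil ?horner0 ?coef0 //.
  by rewrite /bracket mul0r mulr0 subrr.
have [q [qE q0 q1]] : jet
    (fun t => f@_m *: \prod_(i <- m) (a i + t *: bracket (a i) x))
    (f@_m *: \prod_(i <- m) a i).
  apply: jetZ; elim: (m : seq _) => [|i l IHl].
    case: jet1 => p' [p'E ? ?]; exists p'.
    by split=> [t||]; rewrite ?big_nil // -p'E.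
  have [p' [p'E ? ?]] := jetM _ _ _ _ (jetV i) IHl.
  by exists p'; split=> [t||]; rewrite big_cons // p'E.
exists (q + p); split=> [t||]; rewrite ?big_cons ?mulr_algl.
- by rewrite hornerD -pE -qE.
- by rewrite coefD q0 p0.
by rewrite coefD q1 p1 bracketDl.
Qed.

Lemma central_polyEval_bracket f a x y :
  (forall a, central (polyEval a f * y)) ->
  central (bracket (polyEval a f) x * y).
Proof.
move=> fy w; have [p [pE p0 p1]] := polyEval_jet f a x.
(* At each scalar [t] this is the centrality hypothesis for the deformed assignment; the coefficient
   of degree one is the claim. *)
have pyw : p * y%:P * w%:P - w%:P * (p * y%:P) = 0.
  apply: poly_scalar_roots => t.
  by rewrite hornerD hornerN !horner_scalarM !hornerC -pE fy subrr.
have /eqP := congr1 (coefp 1) pyw.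
by rewrite /coefp /= coefB coefCM !coefMC coef0 subr_eq0 p1 => /eqP.
Qed.
End FreeAlgebra.

(** * Sets of values and verbal primeness *)

Section Values.
Variables (F : fieldType) (A : algType F).
Implicit Types (f g h : freeAlg F) (a b c : nat -> A).

Lemma bracket_values f : exists h,
  (forall c, exists a x, polyEval c h = bracket (polyEval a f) x) /\
  (forall a x, exists c, polyEval c h = bracket (polyEval a f) x).
Proof.
have [n fP] := varsIn_bounded f.
exists (bracket f (freeVar F n)); split=> [c|a x].
  by exists c, (c n); rewrite polyEval_bracket polyEval_var.
by eexists; apply: polyEval_bracket_var.
Qed.

Lemma mul_values f g : exists h,
  (forall c, exists a b, polyEval c h = polyEval a f * polyEval b g) /\
  (forall a b, exists c, polyEval c h = polyEval a f * polyEval b g).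
Proof.
have [n fP] := varsIn_bounded f; exists (f * shift n g); split=> [c|a b].
  by exists c; eexists; rewrite polyEvalM polyEval_shift.
exists (fun i => if (i < n)%N then a i else b (i - n)%N).
rewrite polyEvalM polyEval_shift; congr (_ * _).
  by apply: eq_polyEval fP _ => i /= ->.
by apply: eq_bigr => m _; congr (_ * _); apply: eq_bigr => i _;
  rewrite ltnNge leq_addr addKn.
Qed.

Hypotheses (char0 : [pchar F] =i pred0) (hvp : verballyPrime A).

Lemma verballyPrime_bracket_bracket f g :
  (forall a b, central (polyEval a f * polyEval b g)) ->
  forall a b (t w x y : A),
  bracket (bracket (polyEval a f) t) w * polyEval b g * bracket x y = 0.
Proof.
move=> fgZ a b t w x y.
(* A whole polynomial [h] is required, not just the element [u]: passing to commutators deforms the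
   assignment, so every value of [h] must be controlled. *)
pose L u := exists h, (forall c, central (polyEval c h * polyEval b g)) /\
  exists c, polyEval c h = u.
apply: (@bracket_bracket_eq0 _ L) =>
  [v v6|_ [h [hZ [c <-]]]|_ z [h [hZ [c <-]]]|].
- apply/eqP; have/eqP : 6%:R *: v = 0 by rewrite scaler_nat.
  by rewrite scaler_eq0 (pcharf0P _).1.
- exact: hZ.
- have [k [kP kQ]] := bracket_values h; exists k; split; last exact: kQ.
  by move=> d; have [d' [z' ->]] := kP d; apply: central_polyEval_bracket.
by exists f; split=> //; exists a.
Qed.

Lemma central_factors f g :
  ~ polyIdentity A f -> ~ polyIdentity A g ->
  (forall a b, central (polyEval a f * polyEval b g)) ->
  forall a b, central (polyEval a f) /\ central (polyEval b g).
Proof.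
move=> fN0 gN0 fgZ.
have fg_bracket a b x :
    bracket (polyEval a f) x * polyEval b g
    + polyEval a f * bracket (polyEval b g) x = 0.
  by rewrite -bracketMl central_bracket.
(* The values are [f, t] for [h1], [[f, t], w] for [h2], [g, w] for [k1], [x, y] for [v] and g
   [x, y] for [q]. *)
have [h1 [h1P h1Q]] := bracket_values f.
have [h2 [h2P h2Q]] := bracket_values h1.
have [k1 [k1P k1Q]] := bracket_values g.
have [v [vP vQ]] := bracket_values (freeVar F 0).
have [q [qP qQ]] := mul_values g v.
have h1_id : polyIdentity A h1 -> forall a, central (polyEval a f).
  by move=> h10 a x; apply/bracket_eq0P; have [c <-] := h1Q a x.
have k1_id : polyIdentity A k1 -> forall a, central (polyEval a g).
  by move=> k10 a x; apply/bracket_eq0P; have [c <-] := k1Q a x.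
have commutative_case : polyIdentity A v -> forall x : A, central x.
  move=> v0 x y; apply/bracket_eq0P; have [c] := vQ (fun=> x) y.
  by rewrite polyEval_var v0 => <-.
have f_central : (forall a, central (polyEval a f)) ->
    forall a b, central (polyEval a f) /\ central (polyEval b g).
  move=> fZ a b; split=> //; apply: k1_id.
  have [|//|//] := @verballyPrime_eval _ _ f k1 hvp _.
  move=> a' c; have [b' [x ->]] := k1P c.
  by rewrite -[RHS](fg_bracket a' b' x) (central_bracket _ (fZ a')) mul0r add0r.
have g_central : (forall a, central (polyEval a g)) ->
    forall a b, central (polyEval a f) /\ central (polyEval b g).
  move=> gZ a b; split=> //; apply: h1_id.
  have [|//|//] := @verballyPrime_eval _ _ h1 g hvp _.
  move=> c b'; have [a' [x ->]] := h1P c.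
  by rewrite -[RHS](fg_bracket a' b' x) (central_bracket _ (gZ b')) mulr0 addr0.
have [h20|q0] : polyIdentity A h2 \/ polyIdentity A q.
- apply: verballyPrime_eval => // c d.
  have [c1 [w ->]] := h2P c; have [a [t ->]] := h1P c1.
  have [b [d1 ->]] := qP d; have [d2 [y ->]] := vP d1.
  by rewrite mulrA verballyPrime_bracket_bracket.
- have fbZ a t : central (bracket (polyEval a f) t).
    move=> w; apply/bracket_eq0P; have [c <-] := h1Q a t.
    by have [d <-] := h2Q c w.
  have [h10|/k1_id/g_central//] : polyIdentity A h1 \/ polyIdentity A k1.
    apply: verballyPrime_eval => // c d.
    have [a [t ->]] := h1P c; have [b [w ->]] := k1P d.
    have := central_bracket w (central_polyEval_bracket char0 a t (fgZ^~ b)).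
    by rewrite bracketMl (central_bracket _ (fbZ a t)) mul0r add0r.
  exact/f_central/h1_id.
(* Here g [x, y] vanishes identically while [g] does not, so [A] is commutative. *)
have [||/commutative_case AZ a b] := @verballyPrime_eval _ _ g v hvp _ => //.
by move=> b d; have [c <-] := qQ b d.
Qed.
End Values.

Theorem mainTheorem5 (F : fieldType) (hF : [pchar F] =i pred0)
    (A : algType F) (hpi : piAlgebra A) (hvp : verballyPrime A) :
  primenessCentral A.
Proof.
move=> r s f g le_rs fP gP [fgN0 fgZ].
have fN0 : ~ polyIdentity A f.
  by move=> f0; apply: fgN0 => a; rewrite polyEvalM f0 mul0r.
have gN0 : ~ polyIdentity A g.
  by move=> g0; apply: fgN0 => a; rewrite polyEvalM g0 mulr0.
have {}fgZ (a b : nat -> A) : central (polyEval a f * polyEval b g).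
  (* Gluing [a] and [b] at [r], where the variables of [f] and [g] separate, makes the two values
     independent. *)
  have := fgZ (fun i => if (i < r)%N then a i else b i); rewrite polyEvalM.
  rewrite (eq_polyEval (b := a) fP) => [|i /= ->//].
  rewrite (eq_polyEval (b := b) gP) // => i /andP[].
  by rewrite leqNgt => /negPf->.
have fg := central_factors hF hvp fN0 gN0 fgZ.
by split; split=> // a; case: (fg a a).
Qed.
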